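(* For every sequence $l=(l_i)_{i\in\mathbb{N}}$ of natural numbers (positive integers), the $l$-Grigorchuk subshift $\Omega(\eta_l)$, as a dynamical system $(\Omega(\eta_l),\sigma)$ under the left-shift $\sigma$, is uniquely ergodic.
   Context: Let $\mathbb{N}=\{1,2,\dots\}$ and $\mathbb{N}_0=\mathbb{N}\cup\{0\}$. For an infinite word $w$ over a finite alphabet, $\Omega(w)$ is the closure (product of discrete topologies) of $\{\sigma^k(w):k\in\mathbb{N}_0\}$, where $\sigma$ is the left-shift. $l$-Grigorchuk subshift: On the alphabet $\{a,x,y,z\}$, for $\beta\in\{x,y,z\}$ let $\tau_\beta$ be the monoid homomorphism (under concatenation) of finite words with $\tau_\beta(a)=a\beta a$, $\tau_\beta(x)=x$, $\tau_\beta(y)=y$, $\tau_\beta(z)=z$. Put $\beta_k=x,y,z$ according as $k\equiv1,2,0\pmod 3$. For $j\in\mathbb{N}_0$ let $N(j)\ge1$ and $q(j)$ be the unique integers with $j=q(j)+\sum_{i=1}^{N(j)-1}l_i$ and $0\le q(j)<l_{N(j)}$, and put $\tau^{(j)}=\tau_{\beta_1}^{l_1}\circ\tau_{\beta_2}^{l_2}\circ\cdots\circ\tau_{\beta_{N(j)-1}}^{l_{N(j)-1}}\circ\tau_{\beta_{N(j)}}^{q(j)}$ (so $\tau^{(0)}$ is the identity). Then $\eta_l$ is the unique infinite word having $\tau^{(j)}(a)$ as a prefix for all $j\in\mathbb{N}_0$, and $\Omega(\eta_l)$ is the $l$-Grigorchuk subshift. Uniquely ergodic means that there is exactly one $\sigma$-invariant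 Borel probability measure on $\Omega(\eta_l)$. *)

(* Defs.v *)
From HB Require Import structures.
From mathcomp Require Import all_boot all_order all_algebra.
From mathcomp Require Import all_classical all_reals all_analysis.
Set Implicit Arguments.
Unset Strict Implicit.
Unset Printing Implicit Defensive.

Local Open Scope classical_set_scope.

Section UniqueErgodicity.
Variables (R : realType) (X : ptopologicalType) (T : X -> X).

Definition borelType := g_sigma_algebraType (@open X).

Definition invariant_measure (mu : probability borelType R) : Prop :=
  forall A : set borelType, measurable A -> mu (T @^-1` A) = mu A.

(* A [probability] is a function on all sets, whose values outside the
   sigma-algebra are irrelevant: two measures are the same when they agree on
   the measurable sets. *)
Definition uniquely_ergodic : Prop :=
  exists2 mu : probability borelType R, invariant_measure mu &
    forall nu : probability borelType R, invariant_measure nu ->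
      forall A : set borelType, measurable A -> nu A = mu A.

End UniqueErgodicity.

Lemma ptws_shift_continuous (K : topologicalType) :
  continuous ((fun w n => w n.+1) : {ptws nat -> K} -> {ptws nat -> K}).
Proof.
move=> w; apply/cvg_sup.
  exact/fmap_filter/(nbhs_filter (w : {ptws nat -> K})).
move=> i; apply: (@continuous_comp_initial {ptws nat -> K} {ptws nat -> K} K
  (fun f => f i) (fun w n => w n.+1)).
exact: (@proj_continuous nat (fun=> K) i.+1).
Qed.

Section Subshift.
Variable A : finType.

Definition infinite_word := {ptws nat -> discrete_topology A}.

HB.instance Definition _ := Topological.on infinite_word.

Definition left_shift (w : infinite_word) : infinite_word := fun n => w n.+1.

Definition orbit_closure (w : infinite_word) : set infinite_word :=
  closure (range (fun k : nat => iter k left_shift w)).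

Lemma left_shift_continuous : continuous left_shift.
Proof. exact: (@ptws_shift_continuous (discrete_topology A)). Qed.

Lemma orbit_closure_self w : orbit_closure w w.
Proof. by apply: subset_closure; exists 0. Qed.

Lemma orbit_closure_shift w v :
  orbit_closure w v -> orbit_closure w (left_shift v).
Proof.
move=> wv B /left_shift_continuous/wv[_ [[k _ <-] Bk]].
by exists (left_shift (iter k left_shift w)); split => //; exists k.+1.
Qed.

Definition subshift (w : infinite_word) : Type := set_type (orbit_closure w).

HB.instance Definition _ w :=
  Topological.copy (subshift w) (set_type (orbit_closure w)).

HB.instance Definition _ w :=
  isPointed.Build (subshift w) (SigSub (mem_set (@orbit_closure_self w))).

Definition subshift_map (w : infinite_word) (v : subshift w) : subshift w :=
  SigSub (mem_set (@orbit_closure_shift w _ (set_valP v))).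

End Subshift.

Inductive letter := La | Lx | Ly | Lz.

Definition letter_code (c : letter) : 'I_4 :=
  inord (match c with La => 0 | Lx => 1 | Ly => 2 | Lz => 3 end).

Definition letter_decode (i : 'I_4) : letter := nth La [:: La; Lx; Ly; Lz] i.

Lemma letter_codeK : cancel letter_code letter_decode.
Proof. by case; rewrite /letter_code /letter_decode inordK. Qed.

HB.instance Definition _ := Finite.copy letter (can_type letter_codeK).

Definition tau (b : letter) (u : seq letter) : seq letter :=
  flatten [seq if c is La then [:: La; b; La] else [:: c] | c <- u].

Definition beta (k : nat) : letter :=
  match k %% 3 with 1 => Lx | 2 => Ly | _ => Lz end.

Section Grigorchuk.
(* Only the values [l i] with [0 < i] matter. *)
Variable l : nat -> nat.

(* The unique pair (N(j), q(j)) with j = q + l_1 + ... + l_(N-1), q < l_N. *)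
Definition decomposition (j : nat) : nat * nat :=
  get [set p : nat * nat |
    [/\ 0 < p.1, j = p.2 + \sum_(1 <= i < p.1) l i & p.2 < l p.1]].

(* The substitution tau^(j): [foldr] applies the innermost power tau_(beta N)^q
   first and tau_(beta 1)^(l 1) last. *)
Definition tau_upto (j : nat) (u : seq letter) : seq letter :=
  let: (N, q) := decomposition j in
  foldr (fun i => iter (l i) (tau (beta i))) (iter q (tau (beta N)) u)
    (iota 1 N.-1).

Definition is_prefix (u : seq letter) (w : infinite_word letter) : Prop :=
  u = mkseq w (size u).

Definition grigorchuk_word : infinite_word letter :=
  xget (fun=> La)
    [set w : infinite_word letter | forall j, is_prefix (tau_upto j [:: La]) w].

Hypothesis l_gt0 : forall i, 0 < i -> 0 < l i.

Lemma decomposition_unique j p p' :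
  [/\ 0 < p.1, j = p.2 + \sum_(1 <= i < p.1) l i & p.2 < l p.1] ->
  [/\ 0 < p'.1, j = p'.2 + \sum_(1 <= i < p'.1) l i & p'.2 < l p'.1] ->
  p = p'.
Proof.
have aux N q N' q' : 0 < N -> q < l N -> N < N' ->
    q + \sum_(1 <= i < N) l i < q' + \sum_(1 <= i < N') l i.
  move=> N0 qN NN'.
  apply: (@leq_trans (\sum_(1 <= i < N') l i)); last exact: leq_addl.
  rewrite (big_cat_nat N0 (ltnW NN')) /= addnC ltn_add2l.
  by rewrite (big_ltn NN'); apply: leq_trans qN (leq_addr _ _).
case: p p' => [N q] [N' q'] /= [N0 jE qN] [N'0 jE' q'N'].
case: (ltngtP N N') => [NN'|N'N|NN'].
- by have := aux _ _ _ q' N0 qN NN'; rewrite -jE -jE' ltnn.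
- by have := aux _ _ _ q N'0 q'N' N'N; rewrite -jE -jE' ltnn.
- by move: jE; rewrite jE' NN' => /addIn ->.
Qed.

Lemma decomposition_spec j :
  [/\ 0 < (decomposition j).1,
      j = (decomposition j).2 + \sum_(1 <= i < (decomposition j).1) l i &
      (decomposition j).2 < l (decomposition j).1].
Proof.
apply: (@getPex _ [set p : nat * nat |
    [/\ 0 < p.1, j = p.2 + \sum_(1 <= i < p.1) l i & p.2 < l p.1]]).
elim: j => [|j [[N q] /= [N0 jE qN]]].
  by exists (1, 0); split => //=; [rewrite big_geq|exact: l_gt0].
have [qN'|] := ltnP q.+1 (l N); first by exists (N, q.+1); split; rewrite //= jE.
move=> lNq; exists (N.+1, 0); split => //=; last exact: l_gt0.
have lNE : l N = q.+1 by apply/eqP; rewrite eqn_leq lNq qN.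
by rewrite big_nat_recr //= jE lNE add0n addnS addnC.
Qed.

Lemma decompositionE j N q :
  0 < N -> j = q + \sum_(1 <= i < N) l i -> q < l N -> decomposition j = (N, q).
Proof. by move=> ? ? ?; apply: (decomposition_unique (decomposition_spec j)). Qed.

Lemma tau_cat b u v : tau b (u ++ v) = tau b u ++ tau b v.
Proof. by rewrite /tau map_cat flatten_cat. Qed.

Lemma size_tau b u : size u <= size (tau b u).
Proof.
elim: u => //= c u IHu; rewrite size_cat -[(size u).+1]add1n.
by apply: leq_add IHu; case: c.
Qed.

Let comp N u := foldr (fun i => iter (l i) (tau (beta i))) u (iota 1 N).

Let iter_tau_cat n b u v :
  iter n (tau b) (u ++ v) = iter n (tau b) u ++ iter n (tau b) v.
Proof. by elim: n => //= n ->; rewrite tau_cat. Qed.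

Let size_iter_tau n b u : size u <= size (iter n (tau b) u).
Proof. by elim: n => //= n IHn; apply: leq_trans IHn (size_tau _ _). Qed.

Let comp_cat N u v : comp N (u ++ v) = comp N u ++ comp N v.
Proof. by rewrite /comp; elim: (iota 1 N) => //= i s ->; rewrite iter_tau_cat. Qed.

Let size_comp N u : size u <= size (comp N u).
Proof.
rewrite /comp; elim: (iota 1 N) => //= i s IHs.
exact: leq_trans IHs (size_iter_tau _ _ _).
Qed.

Let tau_uptoS j : exists2 v, 0 < size v &
  tau_upto j.+1 [:: La] = tau_upto j [:: La] ++ v.
Proof.
have [] := decomposition_spec j; rewrite {2}/tau_upto.
case: (decomposition j) => [[//|N] q] /= _ jE qN.
have -> : tau_upto j.+1 [:: La] = comp N (iter q.+1 (tau (beta N.+1)) [:: La]).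
  rewrite /tau_upto; have [qN'|lNq] := ltnP q.+1 (l N.+1).
    by rewrite (@decompositionE _ N.+1 q.+1) // jE.
  have lNE : l N.+1 = q.+1 by apply/eqP; rewrite eqn_leq lNq qN.
  rewrite (@decompositionE _ N.+2 0) //; last exact: l_gt0.
    by rewrite [N.+2.-1]/= -(addn1 N) iotaD foldr_cat add1n addn1 /= lNE.
  by rewrite big_nat_recr //= jE lNE add0n addnS addnC.
exists (comp N (iter q (tau (beta N.+1)) [:: beta N.+1; La])).
  by apply: leq_trans (size_comp _ _); apply: leq_trans (size_iter_tau _ _ _).
by rewrite iterSr -comp_cat -iter_tau_cat.
Qed.

Let tau_uptoD j k : exists v,
  tau_upto (j + k) [:: La] = tau_upto j [:: La] ++ v.
Proof.
elim: k => [|k [v IHk]]; first by exists [::]; rewrite addn0 cats0.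
have [v' _ E] := tau_uptoS (j + k).
by exists (v ++ v'); rewrite addnS E IHk catA.
Qed.

Let size_tau_upto j : j < size (tau_upto j [:: La]).
Proof.
elim: j => [|j IHj].
  rewrite /tau_upto (@decompositionE 0 1 0) ?big_geq //; exact: l_gt0.
have [v v0 ->] := tau_uptoS j.
by rewrite size_cat -[j.+2]addn1 leq_add.
Qed.

Lemma grigorchuk_word_prefix j : is_prefix (tau_upto j [:: La]) grigorchuk_word.
Proof.
move: j; apply: (@xgetPex _ _ [set w : infinite_word letter |
  forall j, is_prefix (tau_upto j [:: La]) w]).
exists (fun n => nth La (tau_upto n [:: La]) n) => j.
apply: (@eq_from_nth _ La) => [|n nj]; rewrite ?size_mkseq // nth_mkseq //.
have [jn|nj'] := leqP j n.
  have [v] := tau_uptoD j (n - j); rewrite subnKC // => ->.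
  by rewrite nth_cat nj.
have [v] := tau_uptoD n (j - n); rewrite subnKC 1?ltnW // => ->.
by rewrite nth_cat size_tau_upto.
Qed.

Lemma grigorchuk_word_unique (w : infinite_word letter) :
  (forall j, is_prefix (tau_upto j [:: La]) w) -> w = grigorchuk_word.
Proof.
move=> hw; apply/funext => n.
have nj := size_tau_upto n.
have prefE v : is_prefix (tau_upto n [:: La]) v ->
    v n = nth La (tau_upto n [:: La]) n.
  by rewrite /is_prefix => ->; rewrite nth_mkseq.
by rewrite (prefE _ (hw n)) (prefE _ (grigorchuk_word_prefix n)).
Qed.

End Grigorchuk.

(* Main.v *)
From HB Require Import structures.
Require Import Defs.
From mathcomp Require Import all_boot all_order all_algebra.
From mathcomp Require Import all_classical all_reals all_analysis.
From mathcomp Require Import measurable_realfun zify lra.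

(** The word eta_l is a Toeplitz word of the simplest kind.  Every tau_beta
    fixes x, y and z, so the prefixes p_j := tau^(j)(a) satisfy
    p_(j+1) = p_j b_j p_j with a single letter b_j (lemma [tau_uptoS]), and p_j
    has length 2^(j+1) - 1.  Hence eta_l is 2^m-periodic away from the positions
    congruent to -1 modulo 2^m, for every m ([grigorchuk_word_toeplitz]); this
    is the only property of eta_l that is used ([dyadic_toeplitz]).

    Fix a finite word u and a modulus N = 2^m.  Whether u occurs in eta_l at
    position p depends only on p modulo N, except for the at most |u| residues
    for which the occurrence would cover a position congruent to -1
    ([occurs_at_bounds], [sum_possibly_occurs]).  So the number of occurrences
    of u in any window of N consecutive positions lies between two numbers G and
    G + |u| that do not depend on the window, and u has a frequency which is
    determined with error |u| / N ([is_frequency], [is_frequency_unique]).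

    Uniqueness.  Every point of the subshift looks like eta_l on each finite
    window, so it obeys the same bounds.  Integrating the number of occurrences
    against an invariant probability mu shows that mu of the cylinder of u is
    the frequency of u ([invariant_frequency]), and cylinders form a generating
    pi-system of the Borel sets ([probability_eq_on_cylinders]).

    Existence.  Reading the binary digits of a uniform random t in [0, 1] as the
    digits of a 2-adic integer z gives a Haar distributed z; the random point is
    eta_l seen from the 2-adic position z ([toeplitz_point]).  It is defined for
    every t because binary expansions obtained by truncation never end in an
    infinite string of ones, that is, z is never a negative integer
    ([even_digit]).  As z is equidistributed modulo N, so is its translate by
    any k, and the same bounds show that u occurs at position k of the random
    point with probability the frequency of u, whatever k is
    ([toeplitz_measure_frequency]).  Comparing k = 0 and k = 1 gives invariance
    on cylinders, hence on all Borel sets. *)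

Set Implicit Arguments.
Unset Strict Implicit.
Unset Printing Implicit Defensive.
Import Order.TTheory GRing.Theory Num.Theory.
Local Open Scope classical_set_scope.

(** * Occurrences of finite words in dyadic Toeplitz words *)

(** Periodicity modulo [2 ^ m] of the letters at all positions outside the
    residue class of -1, with [k] as the residue. *)
Definition dyadic_toeplitz (A : Type) (w : nat -> A) :=
  forall m q k, k.+1 < 2 ^ m -> w (k + q * 2 ^ m) = w k.

Section Occurrences.
Variable A : eqType.
Implicit Types (w v : nat -> A) (u : seq A).

Definition occurs_at w u p : bool := mkseq (fun i => w (p + i)) (size u) == u.

Lemma eq_occurs_at w v u p r :
  (forall i, i < size u -> w (p + i) = v (r + i)) ->
  occurs_at w u p = occurs_at v u r.
Proof.
move=> wv; rewrite /occurs_at; congr (_ == u).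
by apply/eq_in_map => i; rewrite mem_iota => /wv.
Qed.

(** Bounds, read off the residue [r] modulo [2 ^ m] of a position, for the
    occurrence of [u] there: they differ only when an occurrence of [u] at [r]
    would cover the position [2 ^ m - 1], whose letter is not determined by its
    residue. *)
Definition surely_occurs w u m r : bool :=
  (r + size u < 2 ^ m) && occurs_at w u r.

Definition possibly_occurs w u m r : bool :=
  (r + size u < 2 ^ m) ==> occurs_at w u r.

(** The second word [v] stands for anything that locally looks like [w]: a point
    of the orbit closure, or the word seen from a 2-adic position. *)
Lemma occurs_at_bounds w v u m s p : dyadic_toeplitz w ->
  (forall i, i < size u -> v (p + i) = w (s + p + i)) ->
  surely_occurs w u m ((s + p) %% 2 ^ m) <= occurs_at v u p
    <= possibly_occurs w u m ((s + p) %% 2 ^ m).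
Proof.
move=> wT vw; rewrite (eq_occurs_at vw) /surely_occurs /possibly_occurs.
set r := (s + p) %% _.
case: ltnP => [rN|_] /=; last by rewrite leq_b1.
suff -> : occurs_at w u (s + p) = occurs_at w u r by rewrite leqnn.
apply: eq_occurs_at => i iu; rewrite (divn_eq (s + p) (2 ^ m)) -/r.
rewrite -addnA addnC; apply: wT; rewrite -addnS.
by apply: leq_ltn_trans rN; rewrite leq_add2l.
Qed.

(** Only the last [size u] residues are undecided. *)
Lemma sum_possibly_occurs w u m :
  \sum_(r < 2 ^ m) possibly_occurs w u m r
    <= \sum_(r < 2 ^ m) surely_occurs w u m r + size u.
Proof.
have near_end N L : \sum_(r < N) (N <= r + L) <= L.
  have [LN|NL] := leqP L N; last first.
    apply: leq_trans (ltnW NL); rewrite -[leqRHS]muln1 -[X in X * 1]card_ord.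
    by rewrite -sum_nat_const leq_sum // => i _; rewrite leq_b1.
  rewrite -(subnK LN) big_split_ord /= big1 ?add0n => [|i _]; last first.
    by rewrite /= leqNgt ltn_add2r ltn_ord.
  rewrite -[leqRHS]muln1 -[X in X * 1]card_ord -sum_nat_const leq_sum // => i _.
  by rewrite leq_b1.
apply: leq_trans (leq_add (leqnn _) (near_end (2 ^ m) (size u))).
rewrite -big_split leq_sum //= => r _; rewrite /possibly_occurs /surely_occurs.
by case: leqP => //=; rewrite addn0.
Qed.

Lemma sum_modn_shift N (h : nat -> nat) s :
  \sum_(k < N) h ((s + k) %% N) = \sum_(r < N) h r.
Proof.
elim: s => [|s <-]; first by apply: eq_bigr => k _; rewrite add0n modn_small.
case: N => [|N]; first by rewrite !big_ord0.
rewrite big_ord_recr big_ord_recl /= addnC addn0 addSnnS modnDr; congr (_ + _).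
by apply: eq_bigr => k _; rewrite /bump addSnnS.
Qed.

End Occurrences.

(** * Words generated by doubling *)

Definition doubling_word (A : Type) (b : nat -> A) (a : A) : nat -> seq A :=
  fix p j := if j is i.+1 then p i ++ b i :: p i else [:: a].

Lemma size_doubling_word A b (a : A) j :
  (size (doubling_word b a j)).+1 = 2 ^ j.+1.
Proof.
by elim: j => //= j IHj; rewrite size_cat /= -addSn IHj addnn -mul2n -expnS.
Qed.

(** The word of index [j + i] is a concatenation of [2 ^ i] copies of the word of
    index [j], separated by single letters; the copies start at the multiples of
    [2 ^ j.+1]. *)
Lemma doubling_word_toeplitz A b (a : A) (w : nat -> A) :
  (forall j n, n.+1 < 2 ^ j.+1 -> w n = nth a (doubling_word b a j) n) ->
  dyadic_toeplitz w.
Proof.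
move=> wE [|j] q k; first by rewrite expn0.
move=> kj; rewrite (wE j k kj).
have step i q' : q' < 2 ^ i ->
    nth a (doubling_word b a (j + i)) (k + q' * 2 ^ j.+1)
      = nth a (doubling_word b a j) k.
  elim: i q' => [|i IHi] q'.
    by rewrite expn0 ltnS leqn0 => /eqP ->; rewrite !addn0.
  have szE : (size (doubling_word b a (j + i))).+1 = 2 ^ i * 2 ^ j.+1.
    by rewrite size_doubling_word -addSn expnD mulnC.
  move=> q'i; rewrite addnS /= nth_cat.
  have [q'i'|iq'] := ltnP q' (2 ^ i).
    suff -> : k + q' * 2 ^ j.+1 < size (doubling_word b a (j + i)) by exact: IHi.
    have := leq_mul q'i' (leqnn (2 ^ j.+1)).
    by rewrite mulSn; lia.
  have -> : k + q' * 2 ^ j.+1 =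
     size (doubling_word b a (j + i)) + (k + (q' - 2 ^ i) * 2 ^ j.+1).+1.
    by rewrite addnS -addSn szE mulnBl addnCA subnKC // leq_mul.
  (* the position lies in the second copy, after the separating letter *)
  rewrite ltnNge leq_addr /= addKn /=; apply: IHi.
  by move: q'i; rewrite expnS; lia.
rewrite (wE (j + q)); first by apply: step; exact: ltn_expl.
rewrite -[(j + q).+1]addSn expnD.
have := ltn_expl q (isT : 1 < 2) => /(leq_mul (leqnn (2 ^ j.+1))).
by rewrite mulnS; lia.
Qed.

(** * The Grigorchuk word is Toeplitz *)

Section Grigorchuk.
Variable l : nat -> nat.
Hypothesis l_gt0 : forall i, 0 < i -> 0 < l i.

(** The body of [tau_upto] for an arbitrary pair [(N, q)], so that two successive
    indices can be compared at the same [N] even when [q.+1 = l N] and the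
    decomposition moves on to [(N.+1, 0)]. *)
Definition tau_level (N q : nat) (u : seq letter) : seq letter :=
  foldr (fun i => iter (l i) (tau (beta i))) (iter q (tau (beta N)) u)
    (iota 1 N.-1).

Lemma beta_neq_La k : beta k <> La.
Proof. by rewrite /beta; case: (k %% 3) => [|[|[]]]. Qed.

Lemma tau_fixed b c : c <> La -> tau b [:: c] = [:: c].
Proof. by case: c. Qed.

Lemma iter_tau_cat n b u v :
  iter n (tau b) (u ++ v) = iter n (tau b) u ++ iter n (tau b) v.
Proof. by elim: n => //= n ->; rewrite tau_cat. Qed.

Lemma iter_tau_fixed n b c : c <> La -> iter n (tau b) [:: c] = [:: c].
Proof. by move=> cLa; elim: n => //= n ->; exact: tau_fixed. Qed.

Lemma tau_level_cat N q u v :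
  tau_level N q (u ++ v) = tau_level N q u ++ tau_level N q v.
Proof.
by rewrite /tau_level iter_tau_cat; elim: iota => //= i s ->; rewrite iter_tau_cat.
Qed.

Lemma tau_level_fixed N q c : c <> La -> tau_level N q [:: c] = [:: c].
Proof.
move=> cLa; rewrite /tau_level iter_tau_fixed //.
by elim: iota => //= i s ->; exact: iter_tau_fixed.
Qed.

(** One more innermost substitution turns [La] into [La; beta; La]; the outer
    ones are morphisms and fix the middle letter. *)
Lemma tau_uptoS j :
  tau_upto l j.+1 [:: La] = tau_upto l j [:: La] ++
    beta (decomposition l j).1 :: tau_upto l j [:: La].
Proof.
have [] := decomposition_spec l_gt0 j; rewrite {2 3}/tau_upto.
case: (decomposition l j) => [[//|N] q] /= _ jE qN.
have -> : tau_upto l j.+1 [:: La] = tau_level N.+1 q.+1 [:: La].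
  rewrite /tau_upto; have [qN'|lNq] := ltnP q.+1 (l N.+1).
    by rewrite (@decompositionE _ l_gt0 _ N.+1 q.+1) // jE.
  have lNE : l N.+1 = q.+1 by apply/eqP; rewrite eqn_leq lNq qN.
  rewrite (@decompositionE _ l_gt0 _ N.+2 0) //; last exact: l_gt0.
    rewrite [N.+2.-1]/= -(addn1 N) iotaD foldr_cat add1n addn1 /= lNE.
    by rewrite /tau_level.
  by rewrite big_nat_recr //= jE lNE add0n addnS addnC.
have -> : tau_level N.+1 q.+1 [:: La] =
    tau_level N.+1 q ([:: La] ++ [:: beta N.+1] ++ [:: La]).
  by rewrite /tau_level iterSr.
by rewrite !tau_level_cat (@tau_level_fixed _ _ (beta _) (@beta_neq_La _)).
Qed.

Lemma tau_upto_doubling j : tau_upto l j [:: La] =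
  doubling_word (fun i => beta (decomposition l i).1) La j.
Proof.
elim: j => [|j IHj]; last by rewrite tau_uptoS IHj.
by rewrite /tau_upto (@decompositionE _ l_gt0 0 1 0) ?big_geq //; exact: l_gt0.
Qed.

Lemma grigorchuk_word_toeplitz : dyadic_toeplitz (grigorchuk_word l).
Proof.
apply: (@doubling_word_toeplitz _ (fun i => beta (decomposition l i).1) La).
move=> j n nj.
rewrite -tau_upto_doubling (grigorchuk_word_prefix l_gt0 j) nth_mkseq //.
by rewrite tau_upto_doubling -ltnS size_doubling_word.
Qed.

End Grigorchuk.

(** * Cylinders and Borel sets of a subshift *)

Section Cylinders.
Variable A : finType.
Implicit Types (w v : infinite_word A) (u : seq A).

(** Cylinders are a neighbourhood basis: their filter at [v] converges to [v] in
    the product topology because it does so coordinatewise. *)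
Lemma nbhs_prefix v (U : set (infinite_word A)) : nbhs v U ->
  exists n, forall v', (forall i, i < n -> v' i = v i) -> U v'.
Proof.
pose F : set_system (infinite_word A) :=
  filter_from [set: nat] (fun n => [set v' | forall i, i < n -> v' i = v i]).
have FF : Filter F.
  apply: filter_from_filter; first by exists 0.
  move=> i j _ _; exists (maxn i j) => // v' /= H; split=> k kl; apply: H.
    by rewrite leq_max kl.
  by rewrite leq_max kl orbT.
suff Fv : F --> v by move=> /Fv [n _ H]; exists n.
apply/cvg_sup => i B.
rewrite nbhsE => -[C [[D _ DC]] Cv CB].
exists i.+1 => // v' /= H; apply: CB.
by move: Cv; rewrite -DC /= /proj /= H.
Qed.

Lemma prefix_nbhs v n : nbhs v [set v' | forall i, i < n -> v' i = v i].
Proof.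
elim: n => [|n IHn]; first exact: filterS filterT.
have vn : nbhs v [set v' | v' n = v n].
  have /= := @proj_continuous nat (fun=> discrete_topology A) n v.
  by move=> /(_ [set v n]); apply; rewrite nbhs_principalE.
apply: filterS2 IHn vn => v' /= H Hn i; rewrite ltnS leq_eqVlt.
by case/predU1P => [->//|]; exact: H.
Qed.

Lemma open_occurs_at u p : open [set v : infinite_word A | occurs_at v u p].
Proof.
rewrite openE => v /= vu.
apply: filterS (prefix_nbhs v (p + size u)) => v' /= v'v.
by rewrite (@eq_occurs_at _ v' v _ _ p) // => i iu; rewrite v'v // ltn_add2l.
Qed.

Lemma iter_left_shift k w i : iter k (@left_shift A) w i = w (k + i).
Proof. by elim: k i => //= k IHk i; rewrite /left_shift IHk addnS. Qed.

Lemma orbit_closure_factor w v n : orbit_closure w v ->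
  exists s, forall i, i < n -> v i = w (s + i).
Proof.
move=> /(_ _ (prefix_nbhs v n)) [_ [[s _ <-] vs]].
by exists s => i /vs; rewrite iter_left_shift.
Qed.

Lemma factor_orbit_closure w v :
  (forall n, exists s, forall i, i < n -> v i = w (s + i)) -> orbit_closure w v.
Proof.
move=> H U /nbhs_prefix [n nU]; have [s vs] := H n.
exists (iter s (@left_shift A) w); split; first by exists s.
by apply: nU => i /vs ->; exact: iter_left_shift.
Qed.

End Cylinders.

Section Borel.
Variables (A : finType) (w : infinite_word A).
Implicit Types (u : seq A).

Definition cylinder u p : set (borelType (subshift w)) :=
  [set v : subshift w | occurs_at (set_val v) u p].

Lemma measurable_cylinder u p : measurable (cylinder u p).
Proof.
apply: sub_sigma_algebra.
by exists [set v : infinite_word A | occurs_at v u p] => //; exact: open_occurs_at.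
Qed.

(** The empty set is added because two cylinders may be disjoint and the family
    has to be closed under intersection. *)
Definition cylinders : set (set (borelType (subshift w))) :=
  set0 |` range (cylinder^~ 0).

(** Two cylinders at position 0 are either nested or disjoint. *)
Lemma cylinders_setI : setI_closed cylinders.
Proof.
have nested u u' : size u <= size u' -> cylinder u 0 `&` cylinder u' 0 !=set0 ->
    cylinder u' 0 `<=` cylinder u 0.
  move=> uu' [v0 []]; rewrite /cylinder/= /occurs_at => /eqP v0u /eqP v0u' v /=.
  move=> /eqP vu'; apply/eqP; rewrite -v0u.
  have pref (x : nat -> A) : mkseq (fun i => x (0 + i)) (size u) =
      take (size u) (mkseq (fun i => x (0 + i)) (size u')).
    by rewrite /mkseq -map_take take_iota (minn_idPl uu').
  by rewrite size_mkseq !pref vu' v0u'.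
move=> B C [->|[u _ <-]]; first by rewrite set0I; left.
move=> [->|[u' _ <-]]; first by rewrite setI0; left.
have [->|/set0P ne] := eqVneq (cylinder u 0 `&` cylinder u' 0) set0; first by left.
right; have [uu'|/ltnW u'u] := leqP (size u) (size u').
  by exists u' => //; rewrite setIidr //; exact: nested.
by exists u => //; rewrite setIidl //; apply: nested => //; rewrite setIC.
Qed.

(** An open set is the union of the cylinders that it contains, and there are
    only countably many finite words. *)
Lemma measurable_cylinders :
  @measurable _ (borelType (subshift w)) = <<s cylinders >>.
Proof.
apply/seteqP; split; last first.
  apply: smallest_sub; first exact: sigma_algebra_measurable.
  by move=> _ [->|[u _ <-]]; [exact: measurable0|exact: measurable_cylinder].
apply: smallest_sub; first exact: smallest_sigma_algebra.
move=> U Uo; pose good u := cylinder u 0 `<=` U.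
suff -> : U = \bigcup_u (if `[< good u >] then cylinder u 0 else set0).
  apply: (@countable_bigcupT_measurable _ (g_sigma_algebraType cylinders)) => //.
  move=> u; apply: sub_sigma_algebra.
  by case: ifP => _; [right; exists u|left].
apply/seteqP; split => [v Uv|v [u _]]; last by case: asboolP => // Hu; exact: Hu.
case: Uo => V Vo VU.
have [n nV] : exists n, forall v', (forall i, i < n -> v' i = set_val v i) -> V v'.
  apply: nbhs_prefix; apply: open_nbhs_nbhs; split => //.
  by move: Uv; rewrite -VU.
have vc : cylinder (mkseq (set_val v) n) 0 v.
  by rewrite /cylinder /= /occurs_at size_mkseq.
exists (mkseq (set_val v) n) => //; case: asboolP => // -[] v'.
rewrite /cylinder /= /occurs_at size_mkseq -VU => /eqP v'v; apply: nV => i ni.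
have /(congr1 (fun s => nth (set_val v 0) s i)) := v'v.
by rewrite !nth_mkseq.
Qed.

Lemma subshift_map_cylinder u p :
  @subshift_map A w @^-1` cylinder u p = cylinder u p.+1.
Proof. by []. Qed.

Lemma measurable_subshift_map :
  measurable_fun (setT : set (borelType (subshift w)))
    (@subshift_map A w : borelType (subshift w) -> borelType (subshift w)).
Proof.
apply: (measurability cylinders measurable_cylinders) => _ [B + <-].
case=> [->|[u _ <-]]; rewrite setTI; first by rewrite preimage_set0.
by rewrite subshift_map_cylinder; exact: measurable_cylinder.
Qed.

Lemma probability_eq_on_cylinders (R : realType)
    (mu nu : probability (borelType (subshift w)) R) :
  (forall u, mu (cylinder u 0) = nu (cylinder u 0)) ->
  forall B, measurable B -> mu B = nu B.
Proof.
move=> H.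
have cylT : cylinder [::] 0 = setT by apply/seteqP; split.
apply: (measure_unique cylinders (fun=> cylinder [::] 0)).
- exact: measurable_cylinders.
- exact: cylinders_setI.
- by move=> _; right; exists [::].
- by rewrite bigcup_const //; exists 0.
- by move=> _ [->|[u _ <-]]; [rewrite !measure0|exact: H].
- by move=> _; rewrite cylT; apply: le_lt_trans (probability_le1 _ _) (ltry _).
Qed.

End Borel.
Arguments cylinder {A} w u p.
Arguments measurable_cylinder {A} w u p.

(** * Frequencies and invariant measures *)

Section Frequency.
Variable R : realType.

(** The numbers [x] compatible with the bounds on the density of occurrences of
    [u] modulo [2 ^ m], at every scale [m]. *)
Definition is_frequency (A : eqType) (w : nat -> A) (u : seq A) (x : R) :=
  forall m, ((\sum_(r < 2 ^ m) surely_occurs w u m r)%:R <= (2 ^ m)%:R * x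
             <= (\sum_(r < 2 ^ m) possibly_occurs w u m r)%:R)%R.

(** At scale [m] the two bounds differ by at most [size u], so [x] and [y] differ
    by at most [size u / 2 ^ m]. *)
Lemma is_frequency_le (A : eqType) (w : nat -> A) u x y :
  is_frequency w u x -> is_frequency w u y -> (x <= y)%R.
Proof.
move=> fx fy; rewrite leNgt; apply/negP => yx.
pose d := (x - y)%R.
have d0 : (0 < d)%R by rewrite subr_gt0.
pose m := (Num.truncn ((size u)%:R / d)).+1.
have mE : ((size u)%:R < m%:R * d)%R by rewrite -ltr_pdivrMr // truncnS_gt.
have /andP[_ xm] := fx m.
have /andP[ym _] := fy m.
have : ((2 ^ m)%:R * d <= (size u)%:R)%R.
  have := sum_possibly_occurs w u m; rewrite -(ler_nat R) natrD /d mulrBr.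
  lra.
apply/negP; rewrite -ltNge (lt_le_trans mE) // ler_pM2r // ler_nat.
exact/ltnW/ltn_expl.
Qed.

Lemma is_frequency_unique (A : eqType) (w : nat -> A) u x y :
  is_frequency w u x -> is_frequency w u y -> x = y.
Proof.
move=> fx fy; apply/le_anti.
by rewrite (is_frequency_le fx fy) (is_frequency_le fy fx).
Qed.

(** The sum of the probabilities is the expected number of events that occur. *)
Lemma sum_probability_bounds d (T : measurableType d) (P : probability T R)
    (n : nat) (C : 'I_n -> T -> bool) (a b : nat) :
  (forall i, measurable [set t | C i t]) ->
  (forall t, a <= \sum_(i < n) C i t <= b) ->
  ((a%:R)%:E <= \sum_(i < n) P [set t | C i t] <= (b%:R)%:E)%E.
Proof.
move=> mC abC.
have indE i : (fun t => (C i t)%:R%R) = (\1_[set t | C i t])%R :> (T -> R).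
  apply/funext => t; rewrite indicE; congr ((nat_of_bool _)%:R)%R.
  by apply/idP/idP; rewrite inE.
have mC' i : measurable_fun setT (fun t => (C i t)%:R%R : R).
  by rewrite indE; exact: measurable_indic.
have intE : (\sum_(i < n) P [set t | C i t] =
    \int[P]_t ((\sum_(i < n) C i t)%:R)%:E)%E.
  transitivity (\sum_(i < n) \int[P]_t ((C i t)%:R)%:E)%E.
    apply: eq_bigr => i _; rewrite -[X in P X]setIT -integral_indic //.
    by rewrite -indE.
  rewrite -ge0_integral_sum //.
    by apply: eq_integral => t _; rewrite natr_sum sumEFin.
  by move=> i; exact/measurable_EFinP.
have mS : measurable_fun setT (fun t => ((\sum_(i < n) C i t)%:R : R)%R%:E).
  apply/measurable_EFinP; under eq_fun do rewrite natr_sum.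
  exact: measurable_sum.
have cstE (c : nat) : (c%:R%:E = \int[P]_t (c%:R)%:E)%E.
  by rewrite integral_cst // -[LHS]mule1 -(probability_setT P).
rewrite intE (cstE a) (cstE b); apply/andP; split; apply: ge0_le_integral => //.
  by move=> t _; rewrite lee_fin ler_nat; case/andP: (abC t).
by move=> t _; rewrite lee_fin ler_nat; case/andP: (abC t).
Qed.

End Frequency.

Section Invariant.
Variables (R : realType) (A : finType) (w : infinite_word A).
Hypothesis wT : dyadic_toeplitz w.

Lemma subshift_occurrences (v : subshift w) u m :
  \sum_(r < 2 ^ m) surely_occurs w u m r
    <= \sum_(k < 2 ^ m) occurs_at (set_val v) u k
    <= \sum_(r < 2 ^ m) possibly_occurs w u m r.
Proof.
have [s vs] := @orbit_closure_factor _ w _ (2 ^ m + size u) (set_valP v).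
rewrite -(sum_modn_shift _ (surely_occurs w u m) s).
rewrite -(sum_modn_shift _ (possibly_occurs w u m) s).
have bounds (k : 'I_(2 ^ m)) : surely_occurs w u m ((s + k) %% 2 ^ m)
    <= occurs_at (set_val v) u k <= possibly_occurs w u m ((s + k) %% 2 ^ m).
  apply: occurs_at_bounds => // i iu.
  by rewrite -addnA; apply: vs; rewrite -addnS leq_add // ltnW.
by apply/andP; split; apply: leq_sum => k _; case/andP: (bounds k).
Qed.

Lemma invariant_cylinder (mu : probability (borelType (subshift w)) R) :
  invariant_measure (@subshift_map A w) mu ->
  forall u k, mu (cylinder w u k) = mu (cylinder w u 0).
Proof.
move=> inv u; elim=> // k <-.
exact: (inv _ (measurable_cylinder w u k)).
Qed.

(** By invariance [2 ^ m] times the measure of the cylinder is the expected number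
    of occurrences of [u] in a window of length [2 ^ m]. *)
Lemma invariant_frequency (mu : probability (borelType (subshift w)) R) u :
  invariant_measure (@subshift_map A w) mu ->
  is_frequency w u (fine (mu (cylinder w u 0))).
Proof.
move=> inv m.
have := @sum_probability_bounds R _ _ mu (2 ^ m)
  (fun k v => occurs_at (set_val v) u k) _ _
  (fun k => measurable_cylinder w u k) (fun v => subshift_occurrences v u m).
rewrite (eq_bigr (fun=> mu (cylinder w u 0))); last first.
  by move=> k _; exact: (invariant_cylinder inv).
have /fineK <- : mu (cylinder w u 0) \is a fin_num.
  by apply: fin_num_measure; exact: measurable_cylinder.
rewrite sumEFin !lee_fin sumr_const card_ord mulr_natl //.
Qed.

End Invariant.

(** * Binary expansions and 2-adic positions *)

(** Reversal of the [m] lowest bits of [n].  The first [m] binary digits of a real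
    number, read as an integer, have the most significant digit first, whereas
    in a 2-adic integer the first digit carries the lowest weight. *)
Fixpoint bit_reversal (m n : nat) : nat :=
  if m is m'.+1 then bit_reversal m' n./2 + odd n * 2 ^ m' else 0.

(** Bit reversal permutes the integers below [2 ^ m]. *)
Lemma sum_bit_reversal m (h : nat -> nat) :
  \sum_(n < 2 ^ m) h (bit_reversal m n) = \sum_(k < 2 ^ m) h k.
Proof.
elim: m h => [|m IHm] h; first by rewrite expn0 !big_ord1.
have parity N (f : nat -> nat) :
    \sum_(i < N.*2) f i = \sum_(i < N) (f i.*2 + f i.*2.+1).
  elim: N => [|N IHN]; first by rewrite !big_ord0.
  by rewrite doubleS !big_ord_recr /= IHN addnA.
rewrite expnS mul2n (parity _ (fun n => h (bit_reversal m.+1 n))).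
rewrite (eq_bigr (fun i : 'I__ => h (bit_reversal m i) +
    h (bit_reversal m i + 2 ^ m))) => [|i _]; last first.
  by rewrite /= odd_double uphalf_double doubleK mul0n mul1n addn0.
rewrite big_split /= (IHm h) (IHm (fun k => h (k + 2 ^ m))) -addnn big_split_ord.
by congr (_ + _); apply: eq_bigr => i _ /=; rewrite addnC.
Qed.

Section DyadicExpansion.
Variable R : realType.
Implicit Types (t : R) (m : nat).

Definition scaled_trunc m t : nat := Num.truncn ((2 ^ m)%:R * t)%R.

(** The residue modulo [2 ^ m] of the 2-adic integer whose digits are the binary
    digits of [t]. *)
Definition dyadic_point m t : nat := bit_reversal m (scaled_trunc m t).

Lemma scaled_trunc_half m t : scaled_trunc m t = (scaled_trunc m.+1 t)./2.
Proof.
have leE n : (scaled_trunc m t <= n) = ((scaled_trunc m.+1 t)./2 <= n).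
  rewrite /scaled_trunc truncn_le_nat leq_half_double truncn_le_nat.
  rewrite expnS natrM -(doubleS n) -mul2n natrM -mulrA ltr_pM2l //.
by apply/eqP; rewrite eqn_leq leE leqnn -leE leqnn.
Qed.

Lemma dyadic_pointS m t : dyadic_point m.+1 t =
  dyadic_point m t + odd (scaled_trunc m.+1 t) * 2 ^ m.
Proof. by rewrite /dyadic_point /= -scaled_trunc_half. Qed.

Lemma dyadic_point_lt m t : dyadic_point m t < 2 ^ m.
Proof.
elim: m => // m IHm; rewrite dyadic_pointS expnS mul2n -addnn -addSn leq_add //.
by case: odd; rewrite ?mul1n ?mul0n.
Qed.

Lemma dyadic_point_mod m i t :
  exists q, dyadic_point (m + i) t = dyadic_point m t + q * 2 ^ m.
Proof.
elim: i => [|i [q IHi]]; first by exists 0; rewrite !addn0.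
exists (q + odd (scaled_trunc (m + i).+1 t) * 2 ^ i).
by rewrite addnS dyadic_pointS IHi expnD; lia.
Qed.

(** Let [a] be the truncation of [2 ^ m * t].  If all digits from place [m] on
    were ones, then [2 ^ (m + i) * t] would stay within 1 of [2 ^ i * a.+1]; but
    [2 ^ m * t < a.+1], and this gap doubles with every step. *)
Lemma even_digit m t : exists i, ~~ odd (scaled_trunc (m + i).+1 t).
Proof.
apply: contrapT => /forallNP odds.
pose a := scaled_trunc m t.
have aE i : (scaled_trunc (m + i) t).+1 = a.+1 * 2 ^ i.
  elim: i => [|i IHi]; first by rewrite addn0 muln1.
  have := odd_double_half (scaled_trunc (m + i).+1 t).
  move/negP/negPn: (odds i) => ->; rewrite -scaled_trunc_half addnS => <-.
  by rewrite expnS mulnCA -IHi mul2n doubleS.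
pose e := (a.+1%:R - (2 ^ m)%:R * t)%R.
have e0 : (0 < e)%R by rewrite subr_gt0 -truncn_le_nat.
have small i : ((2 ^ i.+1)%:R * e <= 1)%R.
  have : ((scaled_trunc (m + i).+1 t)%:R <= (2 ^ (m + i).+1)%:R * t)%R.
    rewrite truncn_le; apply: le_trans ler01 _; rewrite -truncn_gt0.
    by move/negP/negPn: (odds i); rewrite /scaled_trunc; case: Num.truncn.
  have := congr1 (fun n => n%:R%R : R) (aE i.+1).
  rewrite addnS -natr1 /e mulrBr mulrA -!natrM -addnS expnD.
  rewrite [2 ^ i.+1 * a.+1]mulnC [2 ^ i.+1 * _]mulnC.
  lra.
pose i := Num.truncn (e^-1).
have := small i; apply/negP; rewrite -ltNge -ltr_pdivrMr // mul1r.
apply: lt_le_trans (truncnS_gt _) _; rewrite ler_nat -/i.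
exact/ltnW/ltn_expl.
Qed.

(** A zero digit in place [m] makes the residue modulo [2 ^ m.+1] smaller than
    [2 ^ m], which leaves room for [n] as soon as [n <= 2 ^ m]. *)
Lemma dyadic_point_gap m n t :
  exists i, dyadic_point (m + i) t + n < 2 ^ (m + i).
Proof.
have [i even_i] := even_digit (m + n) t.
exists (n + i).+1; rewrite addnS addnA dyadic_pointS (negbTE even_i) mul0n addn0.
rewrite expnS mul2n -addnn -addSn leq_add ?dyadic_point_lt //.
apply: leq_trans (ltnW (ltn_expl n (isT : 1 < 2))) _.
by rewrite leq_exp2l // addnAC leq_addl.
Qed.

End DyadicExpansion.

Section ToeplitzPoint.
Variables (R : realType) (A : Type) (w : nat -> A).
Hypothesis wT : dyadic_toeplitz w.

(** The word [w] seen from the 2-adic position given by [t]: the letters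
    [w (dyadic_point m t + n)] agree for all [m] satisfying the condition when
    [w] is a dyadic Toeplitz word, and such [m] exist by [dyadic_point_gap]. *)
Definition toeplitz_point (t : R) (n : nat) : A :=
  w (dyadic_point (xget 0 [set m | (dyadic_point m t + n).+1 < 2 ^ m]) t + n).

Lemma toeplitz_pointE t m n : (dyadic_point m t + n).+1 < 2 ^ m ->
  toeplitz_point t n = w (dyadic_point m t + n).
Proof.
have same m1 i : (dyadic_point m1 t + n).+1 < 2 ^ m1 ->
    w (dyadic_point (m1 + i) t + n) = w (dyadic_point m1 t + n).
  by have [q ->] := dyadic_point_mod m1 i t; rewrite addnAC; exact: wT.
move=> mn; rewrite /toeplitz_point.
case: xgetP => [m' _ m'n|]; last by move=> /(_ m).
have [mm'|/ltnW m'm] := leqP m m'.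
  by rewrite -(subnKC mm') same.
by rewrite -[in RHS](subnKC m'm) same.
Qed.

Lemma toeplitz_point_factor t m n : exists q,
  forall i, i < n -> toeplitz_point t i = w (dyadic_point m t + q * 2 ^ m + i).
Proof.
have [j jn] := dyadic_point_gap m n t.
have [q qE] := dyadic_point_mod m j t.
exists q => i ni; rewrite -qE; apply: toeplitz_pointE.
by apply: leq_ltn_trans jn; rewrite -addnS leq_add2l.
Qed.

End ToeplitzPoint.

(** * The image of the uniform distribution *)

Section UniformDigits.
Variable R : realType.

Definition unit_uniform : probability (measurableTypeR R) R :=
  uniform_prob (@ltr01 R).

Lemma measurable_scaled_trunc_pred m (h : nat -> bool) :
  measurable [set t : R | h (scaled_trunc m t)].
Proof.
have mle n : measurable [set t : R | scaled_trunc m t <= n].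
  have -> : [set t : R | scaled_trunc m t <= n] = `]-oo, (n.+1%:R / (2 ^ m)%:R)%R[.
    apply/seteqP; split=> t /=; rewrite in_itv /= /scaled_trunc truncn_le_nat;
    by rewrite ltr_pdivlMr ?ltr0n ?expn_gt0 // mulrC.
  exact: measurable_itv.
have meq n : measurable [set t : R | scaled_trunc m t = n].
  case: n => [|n].
    have -> : [set t : R | scaled_trunc m t = 0] = [set t | scaled_trunc m t <= 0].
      by apply/seteqP; split=> t /=; [move=> ->|rewrite leqn0 => /eqP].
    exact: mle.
  have -> : [set t : R | scaled_trunc m t = n.+1] =
      [set t | scaled_trunc m t <= n.+1] `\` [set t | scaled_trunc m t <= n].
    by apply/seteqP; split=> t /=; [move=> ->; rewrite ltnn|lia].
  exact: measurableD.
have -> : [set t : R | h (scaled_trunc m t)] =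
    \bigcup_(n in [set n | h n]) [set t | scaled_trunc m t = n].
  apply/seteqP; split=> [t ht|t [n /= hn tn]]; last by rewrite tn.
  by exists (scaled_trunc m t).
exact: bigcup_measurable.
Qed.

Lemma unit_uniform_scaled_trunc m a : a < 2 ^ m ->
  unit_uniform [set t | scaled_trunc m t == a] = ((2 ^ m)%:R^-1)%:E.
Proof.
move=> am; rewrite /unit_uniform /= /uniform_prob integral_uniform_pdf.
have N0 : (0 < (2 ^ m)%:R :> R)%R by rewrite ltr0n expn_gt0.
have -> : [set t | scaled_trunc m t == a] `&` `[0%R, 1%R] =
    `[(a%:R / (2 ^ m)%:R)%R, (a.+1%:R / (2 ^ m)%:R)%R[ :> set R.
  apply/seteqP; split=> t /=; rewrite !in_itv /= ler_pdivrMr // ltr_pdivlMr //.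
    move=> [+ /andP[t0 _]]; rewrite mulrC truncn_eq //.
    by rewrite mulr_ge0 // ltW.
  move=> /andP[at0 ta].
  have t0 : (0 <= t)%R by rewrite -(pmulr_lge0 _ N0) (le_trans _ at0).
  rewrite /scaled_trunc mulrC truncn_eq ?mulr_ge0 ?(ltW N0) // at0 ta; split=> //.
  rewrite t0 /= -(ler_pM2r N0) mul1r (le_trans (ltW ta)) //.
  by rewrite ler_nat.
rewrite (eq_integral (cst 1%E)).
  rewrite integral_cst // mul1e [LHS]lebesgue_measure_itv /= lte_fin.
  rewrite ltr_pM2r ?invr_gt0 //.
  rewrite ltr_nat ltnSn -EFinB -mulrBl -natrB // subSnn mul1r //.
move=> t; rewrite inE /= in_itv /= /uniform_pdf => /andP[ta tb].
rewrite subr0 invr1 ifT //; apply/andP; split.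
  by apply: le_trans ta; rewrite divr_ge0 // ltW.
apply: le_trans (ltW tb) _.
by rewrite ler_pdivrMr // mul1r ler_nat.
Qed.


Lemma measurable_dyadic_point_pred m (h : nat -> bool) :
  measurable [set t : R | h (dyadic_point m t)].
Proof. exact: measurable_scaled_trunc_pred m (fun n => h (bit_reversal m n)). Qed.

(** The residue [dyadic_point m] is equidistributed.  Summing over the dyadic
    intervals gives an inequality, because they miss the endpoint 1 and the
    reals outside the unit interval; applying it to [h] and to its negation
    gives the equality. *)
Lemma unit_uniform_count m (h : nat -> bool) :
  ((2 ^ m)%:R * fine (unit_uniform [set t | h (dyadic_point m t)]))%R
    = (\sum_(k < 2 ^ m) h k)%:R%R.
Proof.
pose E (g : nat -> bool) := [set t : measurableTypeR R | g (dyadic_point m t)].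
have mE g : measurable (E g) := measurable_dyadic_point_pred m g.
have finE g : unit_uniform (E g) \is a fin_num by exact: fin_num_measure.
have lower (g : nat -> bool) :
    ((\sum_(k < 2 ^ m) g k)%:R <= (2 ^ m)%:R * fine (unit_uniform (E g)))%R.
  pose F (a : 'I_(2 ^ m)) := [set t : measurableTypeR R | scaled_trunc m t == a].
  have mF a : measurable (F a) :=
    measurable_scaled_trunc_pred m (fun n => n == a :> nat).
  pose G (a : 'I_(2 ^ m)) := g (bit_reversal m a).
  have PB : unit_uniform (\big[setU/set0]_(a < 2 ^ m | G a) F a) =
      ((\sum_(k < 2 ^ m) g k)%:R / (2 ^ m)%:R)%R%:E.
    rewrite measure_bigsetU_ord_cond //; last first.
      apply/trivIsetP => a b _ _ /eqP ab; apply/seteqP; split => // t.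
      by rewrite /F /= => -[/eqP -> /eqP/val_inj].
    rewrite (eq_bigr (fun=> ((2 ^ m)%:R^-1)%R%:E)) => [|a _]; last first.
      exact: unit_uniform_scaled_trunc.
    rewrite sumEFin big_mkcond /= -(sum_bit_reversal m (fun k => g k)) natr_sum.
    rewrite mulr_suml; congr EFin; apply: eq_bigr => a _.
    by rewrite /G; case: (g _); rewrite ?mul1r ?mul0r.
  rewrite -ler_pdivrMl ?ltr0n ?expn_gt0 // mulrC -lee_fin fineK // -PB.
  apply: le_measure; rewrite ?inE //; first exact: bigsetU_measurable.
  apply: (big_ind (fun X => X `<=` E g)) => //; first by move=> X Y; rewrite subUset.
  by move=> a Ga t /eqP ta; rewrite /E /= /dyadic_point ta.
apply/le_anti; rewrite lower andbT.
have := lower (fun k => ~~ h k).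
have -> : E (fun k => ~~ h k) = ~` E h by apply/seteqP; split=> t /=; move/negP.
rewrite probability_setC // -(fineK (finE h)) -EFinB /=.
have : (\sum_(k < 2 ^ m) ~~ h k + \sum_(k < 2 ^ m) h k)%N = (2 ^ m)%N.
  rewrite -big_split /= (eq_bigr (fun=> 1)) => [|k _]; last by case: (h k).
  by rewrite sum_nat_const card_ord muln1.
move=> /(congr1 (fun n => n%:R%R : R)); rewrite natrD mulrBr mulr1 /E.
lra.
Qed.

End UniformDigits.

Section Existence.
Variables (R : realType) (A : finType) (w : infinite_word A).
Hypothesis wT : dyadic_toeplitz w.

Lemma toeplitz_point_in (t : R) : orbit_closure w (toeplitz_point w t).
Proof.
apply: factor_orbit_closure => n; have [q qE] := toeplitz_point_factor wT t 0 n.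
by exists (dyadic_point 0 t + q * 2 ^ 0).
Qed.

Definition toeplitz_map (t : measurableTypeR R) : borelType (subshift w) :=
  SigSub (mem_set (@toeplitz_point_in t)).

(** Whether the random point starts with [u] is decided by one of the residues
    [dyadic_point m], so the preimage of a cylinder is a countable union. *)
Lemma measurable_toeplitz_map :
  measurable_fun (setT : set (measurableTypeR R)) toeplitz_map.
Proof.
apply: (@measurability _ _ _ _ setT toeplitz_map (@cylinders A w)
  (measurable_cylinders w) _) => _ [B + <-].
case=> [->|[u _ <-]]; rewrite setTI; first by rewrite preimage_set0.
have -> : toeplitz_map @^-1` cylinder w u 0 =
    \bigcup_m [set t | surely_occurs w u m (dyadic_point m t)].
  apply/seteqP; split => [t tu|t [m _ /andP[gap tu]]].
    have [m gap] := dyadic_point_gap 0 (size u) t.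
    exists (0 + m) => //; rewrite /= /surely_occurs gap /=.
    rewrite -(@eq_occurs_at _ (toeplitz_point w t) _ _ 0) // => i iu.
    apply: toeplitz_pointE => //.
    by apply: leq_ltn_trans gap; rewrite -addnS leq_add2l.
  rewrite /cylinder /= (@eq_occurs_at _ _ w _ _ (dyadic_point m t)) // => i iu.
  apply: toeplitz_pointE => //.
  by apply: leq_ltn_trans gap; rewrite -addnS leq_add2l.
apply: bigcupT_measurable => m.
exact: (measurable_dyadic_point_pred m (surely_occurs w u m)).
Qed.

HB.instance Definition _ :=
  isMeasurableFun.Build _ _ _ _ toeplitz_map measurable_toeplitz_map.

Definition toeplitz_measure : probability (borelType (subshift w)) R :=
  distribution (unit_uniform R) toeplitz_map.

(** Translating an equidistributed residue by [k] leaves it equidistributed, so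
    the bounds do not depend on [k]. *)
Lemma toeplitz_measure_frequency u k :
  is_frequency w u (fine (toeplitz_measure (cylinder w u k))).
Proof.
move=> m; pose C := [set t : measurableTypeR R | occurs_at (toeplitz_point w t) u k].
have mC : measurable C.
  rewrite -[C]/(toeplitz_map @^-1` cylinder w u k) -[X in measurable X]setTI.
  exact: measurable_toeplitz_map (measurable_cylinder w u k).
rewrite -[toeplitz_measure _]/(unit_uniform R C).
have bounds (t : R) : surely_occurs w u m ((k + dyadic_point m t) %% 2 ^ m)
    <= occurs_at (toeplitz_point w t) u k
    <= possibly_occurs w u m ((k + dyadic_point m t) %% 2 ^ m).
  have [q qE] := toeplitz_point_factor wT t m (k + size u).
  have <- : (dyadic_point m t + q * 2 ^ m + k) %% 2 ^ m =
      (k + dyadic_point m t) %% 2 ^ m by rewrite addnC addnA addnC modnMDl.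
  apply: occurs_at_bounds => // i iu.
  by rewrite -addnA qE // ltn_add2l.
have count (h : nat -> bool) : (\sum_(r < 2 ^ m) h r)%:R%R = ((2 ^ m)%:R *
   fine (unit_uniform R [set t | h ((k + dyadic_point m t) %% 2 ^ m)%N]))%R.
  rewrite (unit_uniform_count R m (fun n => h ((k + n) %% 2 ^ m))).
  by rewrite (sum_modn_shift _ (fun n => h n) k).
have fine_le (X Y : set (measurableTypeR R)) : measurable X -> measurable Y ->
    X `<=` Y -> (fine (unit_uniform R X) <= fine (unit_uniform R Y))%R.
  move=> mX mY XY; rewrite fine_le ?fin_num_measure //.
  by apply: le_measure; rewrite ?inE.
rewrite !count !ler_pM2l ?ltr0n ?expn_gt0 //.
apply/andP; split; apply: fine_le => //.
- exact: (measurable_dyadic_point_pred m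
    (fun n => surely_occurs w u m ((k + n) %% 2 ^ m))).
- by move=> t /= st; have /andP[] := bounds t; rewrite st /C /=; case: occurs_at.
- exact: (measurable_dyadic_point_pred m
    (fun n => possibly_occurs w u m ((k + n) %% 2 ^ m))).
- move=> t; rewrite /C /= => Ct; have /andP[_] := bounds t; rewrite Ct.
  by case: possibly_occurs.
Qed.

Let borel_shift : borelType (subshift w) -> borelType (subshift w) :=
  @subshift_map A w.

HB.instance Definition _ := isMeasurableFun.Build _ _ _ _ borel_shift
  (@measurable_subshift_map A w).

(** The preimage under the shift of the cylinder at position 0 is the cylinder at
    position 1, which has the same measure. *)
Lemma toeplitz_measure_invariant :
  invariant_measure (@subshift_map A w) toeplitz_measure.
Proof.
move=> B mB.
pose shifted : probability (borelType (subshift w)) R := 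
  distribution toeplitz_measure borel_shift.
have := @probability_eq_on_cylinders _ _ _ shifted toeplitz_measure _ B mB.
apply=> u.
have fin k : toeplitz_measure (cylinder w u k) \is a fin_num.
  by apply: fin_num_measure; exact: measurable_cylinder.
rewrite -[LHS]/(toeplitz_measure (cylinder w u 1)) -(fineK (fin 1)) -(fineK (fin 0)).
congr EFin; apply: is_frequency_unique; exact: toeplitz_measure_frequency.
Qed.

End Existence.

Theorem dyadic_toeplitz_uniquely_ergodic (R : realType) (A : finType)
    (w : infinite_word A) :
  dyadic_toeplitz w -> uniquely_ergodic R (@subshift_map A w).
Proof.
move=> wT; exists (toeplitz_measure R wT); first exact: toeplitz_measure_invariant.
move=> nu nu_inv B mB; apply: probability_eq_on_cylinders => // u.
have mC := measurable_cylinder w u 0.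
rewrite -[LHS]fineK ?fin_num_measure // -[RHS]fineK ?fin_num_measure //.
congr EFin; apply: is_frequency_unique (toeplitz_measure_frequency R wT u 0).
exact: invariant_frequency.
Qed.

Theorem corollary4p17 (R : realType) (l : nat -> nat)
    (l_gt0 : forall i : nat, 0 < i -> 0 < l i) :
  uniquely_ergodic R (@subshift_map letter (grigorchuk_word l)).
Proof.
exact/dyadic_toeplitz_uniquely_ergodic/grigorchuk_word_toeplitz.
Qed.
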